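(* Suppose that there exists $\delta>0$ such that $$\|A_i^\top A_j\|\le\delta\quad\text{for all } i\ne j,\qquad\text{and}\qquad \lambda_{\min}(A_i^\top A_i)>3(N-1)\delta\quad\text{for all } i,$$ where $\|\cdot\|$ is the spectral norm and $\lambda_{\min}(A_i^\top A_i)$ denotes the smallest eigenvalue of $A_i^\top A_i$. Then, for any $\rho>0$, the sequence $\{\mathbf{u}^k\}$, $\mathbf{u}^k=(\mathbf{x}_1^k,\dots,\mathbf{x}_N^k,\lambda^k)$, generated by Jacobian ADMM converges to a solution $\mathbf{u}^*$ of the problem $$\min_{\mathbf{x}_1,\ldots,\mathbf{x}_N}\ \sum_{i=1}^N f_i(\mathbf{x}_i)\quad\text{s.t.}\quad \sum_{i=1}^N A_i\mathbf{x}_i=c .$$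
   Context: Setting: $N\ge 2$, $\mathbf{x}_i\in\mathbb{R}^{n_i}$, $A_i\in\mathbb{R}^{m\times n_i}$, $c\in\mathbb{R}^m$, and $f_i:\mathbb{R}^{n_i}\to(-\infty,+\infty]$ are closed proper convex functions. It is assumed that a saddle point (KKT point) exists, i.e. some $\mathbf{u}^*=(\mathbf{x}_1^*,\dots,\mathbf{x}_N^*,\lambda^* )$ with $\lambda^*\in\mathbb{R}^m$, $A_i^\top\lambda^*\in\partial f_i(\mathbf{x}_i^* )$ for all $i$, and $\sum_{i=1}^N A_i\mathbf{x}_i^*=c$. A ''solution $\mathbf{u}^*$'' means such a point. Jacobian ADMM with parameter $\rho>0$: start from arbitrary $\mathbf{x}_i^0\in\mathbb{R}^{n_i}$, $\lambda^0\in\mathbb{R}^m$; for $k=0,1,\dots$, for all $i=1,\dots,N$ (in parallel) $$\mathbf{x}_i^{k+1}=\operatorname*{arg\,min}_{\mathbf{x}_i}\ f_i(\mathbf{x}_i)+\frac{\rho}{2}\Big\|A_i\mathbf{x}_i+\sum_{j\ne i}A_j\mathbf{x}_j^k-c-\frac{\lambda^k}{\rho}\Big\|_2^2,$$ then $\lambda^{k+1}=\lambda^k-\rho\big(\sum_{i=1}^N A_i\mathbf{x}_i^{k+1}-c\big)$. *)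

(* Defs.v *)
From HB Require Import structures.
From mathcomp Require Import all_boot all_order all_algebra.
From mathcomp Require Import all_classical all_reals all_analysis.

Set Implicit Arguments.
Unset Strict Implicit.
Unset Printing Implicit Defensive.

Import Order.TTheory GRing.Theory Num.Theory.
Import numFieldNormedType.Exports.

Local Open Scope classical_set_scope.
Local Open Scope ring_scope.

Definition dotp (R : realType) (n : nat) (u v : 'cV[R]_n) : R :=
  \sum_(i < n) u i 0 * v i 0.

(* The norm `|x| that MathComp-Analysis puts on matrices is the sup norm, hence
   a separate Euclidean norm. *)
Definition l2norm (R : realType) (n : nat) (x : 'cV[R]_n) : R :=
  Num.sqrt (dotp x x).

(* The operator norm induced by the Euclidean norms. *)
Definition spectral_norm (R : realType) (p q : nat) (M : 'M[R]_(p, q)) : R :=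
  sup [set l2norm (M *m x) | x in [set x : 'cV[R]_q | l2norm x <= 1]].

(* Only used for symmetric M: all the complex eigenvalues are then real, left
   and right eigenvectors agree, and for n > 0 the infimum is a minimum. *)
Definition lambda_min (R : realType) (n : nat) (M : 'M[R]_n) : R :=
  inf [set a : R | eigenvalue M a].

Definition proper_fun (R : realType) (n : nat) (f : 'cV[R]_n -> \bar R) : Prop :=
  (forall x, f x != -oo%E) /\ (exists x, f x != +oo%E).

(* For functions that avoid -oo; the case t = 0 is harmless as 0 * +oo = 0. *)
Definition convex_fun (R : realType) (n : nat) (f : 'cV[R]_n -> \bar R) : Prop :=
  forall (x y : 'cV[R]_n) (t : R), 0 <= t <= 1 ->
    (f (t *: x + (1 - t) *: y)%R <= t%:E * f x + (1 - t)%:E * f y)%E.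

Definition epigraph (R : realType) (n : nat) (f : 'cV[R]_n -> \bar R) :
    set ('cV[R]_n * R) :=
  [set p | (f p.1 <= p.2%:E)%E].

Definition closed_fun (R : realType) (n : nat) (f : 'cV[R]_n -> \bar R) : Prop :=
  closed (epigraph f).

Definition subdifferential (R : realType) (n : nat) (f : 'cV[R]_n -> \bar R)
    (x : 'cV[R]_n) : set 'cV[R]_n :=
  [set g | forall y : 'cV[R]_n, (f x + (dotp g (y - x)%R)%:E <= f y)%E].

Definition argmin (R : realType) (n : nat) (F : 'cV[R]_n -> \bar R) :
    set 'cV[R]_n :=
  [set x | forall y, (F x <= F y)%E].

(* KKT points of: minimize \sum_i f i (x i) subject to \sum_i A i *m x i = c. *)
Definition saddle_point (R : realType) (N m : nat) (n : 'I_N -> nat)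
    (A : forall i, 'M[R]_(m, n i)) (c : 'cV[R]_m)
    (f : forall i, 'cV[R]_(n i) -> \bar R)
    (x : forall i, 'cV[R]_(n i)) (lam : 'cV[R]_m) : Prop :=
  (forall i, subdifferential (f i) (x i) ((A i)^T *m lam)) /\
  \sum_(i < N) A i *m x i = c.

(* x k i is the i-th block of the k-th iterate; x 0 and lam 0 are arbitrary. *)
Definition jacobian_admm (R : realType) (N m : nat) (n : 'I_N -> nat)
    (A : forall i, 'M[R]_(m, n i)) (c : 'cV[R]_m)
    (f : forall i, 'cV[R]_(n i) -> \bar R) (rho : R)
    (x : nat -> forall i, 'cV[R]_(n i)) (lam : nat -> 'cV[R]_m) : Prop :=
  forall k : nat,
    (forall i, argmin
       (fun z : 'cV[R]_(n i) =>
          (f i z +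
           (rho / 2 *
            l2norm (A i *m z + \sum_(j < N | j != i) A j *m x k j
                    - c - rho^-1 *: lam k) ^+ 2)%R%:E)%E)
       (x k.+1 i)) /\
    lam k.+1 = lam k - rho *: (\sum_(i < N) A i *m x k.+1 i - c).

(* Main.v *)
(** Write e_i^k = x_i^k - x_i^*, mu^k = lam^k - lam^*, theta = (N - 1) delta and
    let E be the off-diagonal part of A^T A.  Monotonicity of the
    subdifferentials between an iterate and a saddle point gives
    0 <= <A e^(k+1), mu^(k+1)> + rho <e^(k+1), E (e^(k+1) - e^k)>.
    Together with mu^(k+1) = mu^k - rho A e^(k+1) and
    2 |<u, E v>| <= theta (|u|^2 + |v|^2), this makes
    V^k = |mu^k|^2 / rho^2 + theta |e^k|^2 a Lyapunov function, which decreases by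
    at least sum_i (lambda_min (A_i^T A_i) - 3 theta) |e_i^(k+1)|^2.  Hence x^k
    converges to x^* and lam^k is bounded; by closedness of the f_i, any cluster
    point of lam^k is the multiplier of a saddle point with the same x^*, and the
    Lyapunov function of that saddle point tends to 0. *)
Require Import Defs.
From HB Require Import structures.
From mathcomp Require Import all_boot all_order all_algebra.
From mathcomp Require Import all_classical all_reals all_analysis.
From mathcomp Require Import ring lra.
Import Order.TTheory GRing.Theory Num.Theory.
Import numFieldNormedType.Exports.
Local Open Scope classical_set_scope.
Local Open Scope ring_scope.
Set Implicit Arguments.
Unset Strict Implicit.
Unset Printing Implicit Defensive.

(** * Euclidean inner product, spectral norm and smallest eigenvalue *)

Section EuclideanSpace.
Context {R : realType}.

Section Dotp.
Context {n : nat}.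
Implicit Types (u v w : 'cV[R]_n) (a : R).

Lemma dotpE u v : dotp u v = (u^T *m v) 0 0.
Proof. by rewrite mxE; apply: eq_bigr => i _; rewrite mxE. Qed.

Lemma dotpC u v : dotp u v = dotp v u.
Proof. by apply: eq_bigr => i _; rewrite mulrC. Qed.

Lemma dotpDr u v w : dotp u (v + w) = dotp u v + dotp u w.
Proof. by rewrite !dotpE mulmxDr mxE. Qed.

Lemma dotpDl u v w : dotp (u + v) w = dotp u w + dotp v w.
Proof. by rewrite dotpC dotpDr !(dotpC w). Qed.

Lemma dotpZr a u v : dotp u (a *: v) = a * dotp u v.
Proof. by rewrite !dotpE -scalemxAr mxE. Qed.

Lemma dotpZl a u v : dotp (a *: u) v = a * dotp u v.
Proof. by rewrite dotpC dotpZr dotpC. Qed.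

Lemma dotpNr u v : dotp u (- v) = - dotp u v.
Proof. by rewrite -scaleN1r dotpZr mulN1r. Qed.

Lemma dotpNl u v : dotp (- u) v = - dotp u v.
Proof. by rewrite dotpC dotpNr dotpC. Qed.

Lemma dotp0r u : dotp u 0 = 0.
Proof. by rewrite -(scale0r 0) dotpZr mul0r. Qed.

Lemma dotp_sumr (I : Type) (r : seq I) (P : pred I) u (F : I -> 'cV[R]_n) :
  dotp u (\sum_(i <- r | P i) F i) = \sum_(i <- r | P i) dotp u (F i).
Proof. exact: (big_morph _ (dotpDr u) (dotp0r u)). Qed.

Lemma dotp_suml (I : Type) (r : seq I) (P : pred I) u (F : I -> 'cV[R]_n) :
  dotp (\sum_(i <- r | P i) F i) u = \sum_(i <- r | P i) dotp (F i) u.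
Proof. by rewrite dotpC dotp_sumr; apply: eq_bigr => i _; rewrite dotpC. Qed.

Lemma dotp_ge0 u : 0 <= dotp u u.
Proof. by apply: sumr_ge0 => i _; rewrite -expr2 sqr_ge0. Qed.

Lemma sqr_coord_le_dotp u i : u i 0 ^+ 2 <= dotp u u.
Proof.
rewrite /dotp (bigD1 i)//= -expr2 lerDl.
by apply: sumr_ge0 => j _; rewrite -expr2 sqr_ge0.
Qed.

Lemma dotp_gt0 u : u != 0 -> 0 < dotp u u.
Proof.
move=> u0; rewrite lt0r dotp_ge0 andbT; apply: contraNneq u0 => uu0.
apply/eqP/matrixP => i j; rewrite ord1 mxE.
by apply/eqP; rewrite -sqrf_eq0 eq_le sqr_ge0 andbT -uu0 sqr_coord_le_dotp.
Qed.

End Dotp.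

Lemma dotp_mull (p q : nat) (M : 'M[R]_(p, q)) (u : 'cV[R]_q) (v : 'cV[R]_p) :
  dotp (M *m u) v = dotp u (M^T *m v).
Proof. by rewrite !dotpE trmx_mul mulmxA. Qed.

(** For [c > 0] evaluate at the minimizer [t = - b / c]. For [c = 0] and [b != 0], the chosen [t]
    gives the affine function the value [-1]. *)
Lemma discriminant_le (a b c : R) : 0 <= c ->
  (forall t, 0 <= a + 2 * t * b + t ^+ 2 * c) -> b ^+ 2 <= a * c.
Proof.
rewrite le_eqVlt => /predU1P[<- h|c0 h].
  have [->|b0] := eqVneq b 0; first by rewrite expr0n/= mulr0.
  have := h (- (a + 1) / (2 * b)); rewrite mulr0 addr0.
  have -> : 2 * (- (a + 1) / (2 * b)) * b = - (a + 1) by field.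
  lra.
have := h (- b / c).
have -> : a + 2 * (- b / c) * b + (- b / c) ^+ 2 * c = (a * c - b ^+ 2) / c.
  by field; rewrite gt_eqF.
by rewrite pmulr_lge0 ?invr_gt0// subr_ge0.
Qed.

Lemma psd_cauchy_schwarz (n : nat) (P : 'M[R]_n) :
  P^T = P -> (forall x : 'cV[R]_n, 0 <= dotp x (P *m x)) ->
  forall x y : 'cV[R]_n,
    dotp x (P *m y) ^+ 2 <= dotp x (P *m x) * dotp y (P *m y).
Proof.
move=> symP psd x y; apply: discriminant_le => // t.
have := psd (x + t *: y).
rewrite mulmxDr -scalemxAr !dotpDr !dotpDl !(dotpZl, dotpZr).
have -> : dotp y (P *m x) = dotp x (P *m y) by rewrite dotpC dotp_mull symP.
by congr (0 <= _); ring.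
Qed.

Lemma cauchy_schwarz (n : nat) (x y : 'cV[R]_n) :
  dotp x y ^+ 2 <= dotp x x * dotp y y.
Proof.
have := @psd_cauchy_schwarz n 1%:M (trmx1 _ _); rewrite /= => /(_ _ x y).
by rewrite !mul1mx; apply => z; rewrite mul1mx dotp_ge0.
Qed.

(** Cauchy-Schwarz row by row, with the squared Frobenius norm as constant; the added 1 keeps [K]
    positive when [M = 0]. *)
Lemma dotp_mulmx_le (p q : nat) (M : 'M[R]_(p, q)) :
  exists2 K : R, 0 < K &
    forall x : 'cV[R]_q, dotp (M *m x) (M *m x) <= K * dotp x x.
Proof.
pose rowM i : 'cV[R]_q := (row i M)^T.
exists (1 + \sum_i dotp (rowM i) (rowM i)) => [|x].
  by rewrite ltr_wpDr// sumr_ge0// => i _; exact: dotp_ge0.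
rewrite mulrDl mul1r ler_wpDl ?dotp_ge0// mulr_suml; apply: ler_sum => i _.
rewrite -expr2; suff -> : (M *m x) i 0 = dotp (rowM i) x.
  exact: cauchy_schwarz.
by rewrite dotpE trmxK -row_mul [RHS]mxE.
Qed.

Lemma l2norm_ge0 (n : nat) (x : 'cV[R]_n) : 0 <= l2norm x.
Proof. exact: sqrtr_ge0. Qed.

Lemma sqr_l2norm (n : nat) (x : 'cV[R]_n) : l2norm x ^+ 2 = dotp x x.
Proof. by rewrite sqr_sqrtr ?dotp_ge0. Qed.

Lemma l2norm_le (n p : nat) (x : 'cV[R]_n) (y : 'cV[R]_p) (K : R) : 0 <= K ->
  dotp x x <= K ^+ 2 * dotp y y -> l2norm x <= K * l2norm y.
Proof.
move=> K0 le; rewrite -(@ler_pXn2r _ 2) ?nnegrE ?mulr_ge0 ?l2norm_ge0//.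
by rewrite exprMn !sqr_l2norm.
Qed.

Lemma dotp_le_l2norm (n : nat) (x y : 'cV[R]_n) :
  dotp x y <= l2norm x * l2norm y.
Proof.
apply: (le_trans (ler_norm _)).
rewrite -(@ler_pXn2r _ 2) ?nnegrE ?mulr_ge0 ?l2norm_ge0//.
by rewrite real_normK ?num_real// exprMn !sqr_l2norm cauchy_schwarz.
Qed.

(** Normalizing [x] gives a point of the unit ball. [dotp_mulmx_le] bounds the image of that ball,
    so the [sup] really is an upper bound. *)
Lemma l2norm_mulmx_le (p q : nat) (M : 'M[R]_(p, q)) (x : 'cV[R]_q) :
  l2norm (M *m x) <= spectral_norm M * l2norm x.
Proof.
have [->|x0] := eqVneq x 0.
  by rewrite mulmx0 /l2norm !dotp0r sqrtr0 mulr0.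
have xn0 : 0 < l2norm x by rewrite sqrtr_gt0 dotp_gt0.
have -> : l2norm (M *m x) = l2norm (M *m ((l2norm x)^-1 *: x)) * l2norm x.
  apply/eqP; rewrite -(@eqrXn2 _ 2) ?mulr_ge0 ?l2norm_ge0//.
  rewrite exprMn !sqr_l2norm -scalemxAr dotpZl dotpZr -(sqr_l2norm x).
  by apply/eqP; field; rewrite gt_eqF.
rewrite ler_wpM2r ?l2norm_ge0//; apply: sup_upper_bound; last first.
  exists ((l2norm x)^-1 *: x) => //=; rewrite -(@ler_pXn2r _ 2) ?nnegrE ?l2norm_ge0//.
  rewrite sqr_l2norm dotpZl dotpZr -(sqr_l2norm x) expr1n.
  by rewrite (_ : _ * _ = 1)//; field; rewrite gt_eqF.
split; first by exists (l2norm (M *m 0)), 0 => //=; rewrite /l2norm dotp0r sqrtr0.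
have [K K0 MK] := dotp_mulmx_le M.
exists (Num.sqrt K) => _ [y /= y1 <-].
have := @l2norm_le _ _ (M *m y) y (Num.sqrt K); rewrite sqr_sqrtr ?(ltW K0)//.
move=> /(_ (sqrtr_ge0 _) (MK y)) /le_trans; apply.
by rewrite -[leRHS]mulr1 ler_wpM2l ?sqrtr_ge0.
Qed.

Lemma dotp_mulmx_spectral_norm (p q : nat) (M : 'M[R]_(p, q)) (d : R)
    (u : 'cV[R]_p) (v : 'cV[R]_q) :
  spectral_norm M <= d -> 0 <= d ->
  2 * dotp u (M *m v) <= d * (dotp u u + dotp v v).
Proof.
move=> Md d0; have := dotp_le_l2norm u (M *m v).
have := l2norm_mulmx_le M v; rewrite -!sqr_l2norm.
have := l2norm_ge0 u; have := l2norm_ge0 v; have := sqr_ge0 (l2norm u - l2norm v).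
set a := l2norm u; set b := l2norm v; set e := dotp _ _; set s := spectral_norm M.
move=> ab b0 a0 le1 le2.
have h1 : a * l2norm (M *m v) <= a * (d * b).
  by rewrite ler_wpM2l// (le_trans le1)// ler_wpM2r.
have h2 : 0 <= d * (a - b) ^+ 2 by rewrite mulr_ge0.
move: h1 h2 le2; set z := l2norm _ => h1 h2 le2.
apply: (@le_trans _ _ (2 * (a * (d * b)))); first by rewrite ler_pM2l// (le_trans le2).
by rewrite -subr_ge0 (_ : _ - _ = d * (a - b) ^+ 2)//; ring.
Qed.

(** With [y = P x], invertibility gives [|x|^2 <= L |y|^2]. Cauchy-Schwarz for the form of [P] gives
    [|y|^4 <= <y, P y> <x, P x>], and [<y, P y> <= (1 + K) |y|^2]. *)
Lemma psd_unitmx_coercive (n : nat) (P : 'M[R]_n) :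
  P^T = P -> (forall x : 'cV[R]_n, 0 <= dotp x (P *m x)) -> P \in unitmx ->
  exists2 e : R, 0 < e & forall x : 'cV[R]_n, e * dotp x x <= dotp x (P *m x).
Proof.
move=> symP psd Punit.
have [K K0 PK] := dotp_mulmx_le P.
have [L L0 PL] := dotp_mulmx_le (invmx P).
exists (L * (1 + K))^-1 => [|x]; first by rewrite invr_gt0 mulr_gt0// addr_gt0.
rewrite ler_pdivrMl ?mulr_gt0 ?addr_gt0//.
have := PL (P *m x); rewrite mulKmx// => /le_trans; apply.
rewrite -mulrA ler_pM2l//; set y := P *m x.
have [->|y0] := eqVneq y 0.
  by rewrite !dotp0r mulr0.
rewrite -(ler_pM2l (dotp_gt0 y0)).
have := psd_cauchy_schwarz symP psd y x; rewrite -/y expr2 => /le_trans; apply.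
rewrite mulrCA mulrA ler_wpM2r ?psd//.
have := @dotp_le_l2norm _ y (P *m y); have := PK y; have := dotp_ge0 (P *m y).
have := sqr_ge0 (l2norm y - l2norm (P *m y)).
by rewrite -!sqr_l2norm; nra.
Qed.

(** The infimum [mu] of the Rayleigh quotient is shown to be an eigenvalue, whence
    [lambda_min M <= mu]. Coercivity of invertible semidefinite forms replaces the compactness of
    the sphere. *)
Lemma lambda_min_le_rayleigh (n : nat) (M : 'M[R]_n) (x : 'cV[R]_n) :
  M^T = M -> lambda_min M * dotp x x <= dotp x (M *m x).
Proof.
move=> symM.
pose Q := [set dotp y (M *m y) | y in [set y : 'cV[R]_n | dotp y y = 1]].
have Qscale (y : 'cV[R]_n) : y != 0 -> Q (dotp y (M *m y) / dotp y y).
  move=> y0; have yy0 := dotp_gt0 y0; have ny0 : 0 < l2norm y by rewrite sqrtr_gt0.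
  exists ((l2norm y)^-1 *: y) => /=.
    by rewrite dotpZl dotpZr -sqr_l2norm; field; rewrite gt_eqF.
  by rewrite -scalemxAr dotpZl dotpZr -sqr_l2norm; field; rewrite gt_eqF.
have [->|x0] := eqVneq x 0; first by rewrite mulmx0 !dotp0r mulr0.
have lbQ : has_lbound Q.
  have [K K0 MK] := dotp_mulmx_le M.
  exists (- (1 + K)) => _ [y /= y1 <-].
  have := cauchy_schwarz y (M *m y); have := MK y; rewrite y1 mulr1 mul1r.
  nra.
have hasQ : has_inf Q by split => //; eexists; exact: Qscale x0.
set mu := inf Q; have muQ (y : 'cV[R]_n) : mu * dotp y y <= dotp y (M *m y).
  have [->|y0] := eqVneq y 0; first by rewrite mulmx0 !dotp0r mulr0.
  by rewrite -ler_pdivlMr ?dotp_gt0//; apply: ge_inf => //; exact: Qscale.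
have PE (y : 'cV[R]_n) : dotp y ((M - mu%:M) *m y) = dotp y (M *m y) - mu * dotp y y.
  by rewrite mulmxBl mul_scalar_mx dotpDr dotpNr dotpZr.
suff eig : eigenvalue M mu.
  apply: le_trans (muQ x); rewrite ler_wpM2r ?dotp_ge0//.
  (* The infimum is a lower bound only if the eigenvalues are bounded below; [mu] bounds them, by
     [muQ] at the transpose of a left eigenvector. *)
  apply: ge_inf => //=; exists mu => a /= /eigenvalueP[v vM v0].
  have vT0 : v^T != 0 by rewrite trmx_eq0.
  have := muQ v^T; rewrite -{1}symM -trmx_mul vM linearZ/= dotpZr.
  by rewrite ler_pM2r ?dotp_gt0.
(* Otherwise M - mu would be coercive, so mu would not be the infimum of Q. *)
apply: contraT => neig.
have Punit : M - mu%:M \in unitmx.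
  by move: neig; rewrite /eigenvalue /eigenspace negbK kermx_eq0 row_free_unit.
have [||e e0 coer] := psd_unitmx_coercive _ _ Punit.
- by rewrite linearB/= symM tr_scalar_mx.
- by move=> y; rewrite PE subr_ge0.
have : mu + e <= mu; last by rewrite gerDl leNgt e0.
apply: lb_le_inf => [|_ [y /= y1 <-]]; first by case: hasQ.
by have := coer y; rewrite PE y1; lra.
Qed.

End EuclideanSpace.

(** * Convergence of vectors along a filter *)

Section Convergence.
Context {R : realType} {T : Type} {F : set_system T} {FF : ProperFilter F}.

Lemma cvg_sum (V : pseudoMetricNormedZmodType R) (I : Type) (r : seq I) (P : pred I)
    (g : I -> T -> V) (l : I -> V) :
  (forall i, P i -> g i @ F --> l i) ->
  \sum_(i <- r | P i) g i t @[t --> F] --> \sum_(i <- r | P i) l i.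
Proof.
move=> gl; rewrite -(fct_sumE _ _ g).
by apply: (big_ind2 (fun h x => h @ F --> x)) => //;
  [exact: cvg_cst|move=> f x h y; exact: cvgD].
Qed.

Lemma cvg_sum0 (V : pseudoMetricNormedZmodType R) (I : Type) (r : seq I) (P : pred I)
    (g : I -> T -> V) :
  (forall i, P i -> g i @ F --> (0 : V)) ->
  \sum_(i <- r | P i) g i t @[t --> F] --> (0 : V).
Proof. by move=> g0; have := cvg_sum (r := r) g0; rewrite big1. Qed.

Lemma cvg_colP (n : nat) (u : T -> 'cV[R]_n) (l : 'cV[R]_n) :
  u @ F --> l <-> forall i, u t i 0 @[t --> F] --> l i 0.
Proof.
split=> [ul i|ul].
  exact: (@cvg_comp _ _ _ u (fun M : 'cV[R]_n => M i 0) _ _ _ ul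
    (@coord_continuous _ _ _ i 0 l)).
apply/cvg_ballP => e e0.
have /filter_forall : forall i, \forall t \near F, ball (l i 0) e (u t i 0).
  by move=> i; exact: (cvg_ball (ul i)).
apply: filterS => t h; split=> // i j; rewrite ord1; exact: h.
Qed.

Lemma cvg_dotp (n : nat) (u v : T -> 'cV[R]_n) (a b : 'cV[R]_n) :
  u @ F --> a -> v @ F --> b -> dotp (u t) (v t) @[t --> F] --> dotp a b.
Proof.
move=> /cvg_colP ua /cvg_colP vb.
by apply: cvg_sum => i _; exact: cvgM.
Qed.

(** Links the sup-norm topology of matrices to Euclidean estimates: each squared coordinate is at
    most the squared Euclidean norm. *)
Lemma cvg_dotp0P (n : nat) (u : T -> 'cV[R]_n) (l : 'cV[R]_n) :
  u @ F --> l <-> dotp (u t - l) (u t - l) @[t --> F] --> (0 : R).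
Proof.
split=> [ul|ul].
  rewrite -[0](@dotp0r _ n 0).
  by apply: cvg_dotp; apply/subr_cvg0.
apply/cvg_colP => i; apply/subr_cvg0/cvgr0Pnorm_le => e e0.
have e2 : 0 < e ^+ 2 by rewrite exprn_gt0.
move/cvgr0Pnorm_le : ul => /(_ _ e2); apply: filterS => t.
rewrite ger0_norm ?dotp_ge0// => le.
rewrite -(@ler_pXn2r _ 2) ?nnegrE ?(ltW e0)// real_normK ?num_real//.
by apply: le_trans le; have := sqr_coord_le_dotp (u t - l) i; rewrite !mxE.
Qed.

Lemma cvg_mulmx (p q : nat) (M : 'M[R]_(p, q)) (u : T -> 'cV[R]_q) (l : 'cV[R]_q) :
  u @ F --> l -> M *m u t @[t --> F] --> M *m l.
Proof.
move=> /cvg_dotp0P ul; apply/cvg_dotp0P.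
have [K K0 MK] := dotp_mulmx_le M.
apply: (squeeze_cvgr (f := cst 0) (h := fun t => K * dotp (u t - l) (u t - l))).
- by apply: nearW => t /=; rewrite dotp_ge0 -mulmxBr MK.
- exact: cvg_cst.
- by rewrite -(mulr0 K); apply: cvgM => //; exact: cvg_cst.
Qed.

End Convergence.

(** * Cluster points along filters finer than [\oo] *)

Lemma cvg_shiftS_sub (V : topologicalType) (U : set_system nat) (u : nat -> V) (l : V) :
  \oo `<=` U -> u @ \oo --> l -> u k.+1 @[k --> U] --> l.
Proof.
move=> ooU ul B /ul [M _ uB]; apply: ooU; exists M => // k Mk.
by apply: uB; exact: leqW.
Qed.

(** Compactness of the segment gives a cluster point, and an ultrafilter converges to each of its
    cluster points. *)
Lemma ultra_bounded_cvg (R : realType) (T : Type) (U : set_system T) (u : T -> R)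
    (K : R) :
  UltraFilter U -> (forall t, `|u t| <= K) -> exists l : R, u @ U --> l.
Proof.
move=> UU uK; have UP := @ultra_proper _ _ UU.
have := @segment_compact R (- K) K => /(_ (u @ U) _) [|l [_ cl]].
  by apply: (@filterE _ U) => t /=; rewrite in_itv/= -ler_norml.
exists l => B lB.
have [//|UC] := in_ultra_setVsetC (u @^-1` B) UU.
by have [y [/= nBy By]] := cl (~` B) B UC lB.
Qed.

(* A finer filter U plays the role of a subsequence. *)
Lemma bounded_cluster (R : realType) (n : nat) (u : nat -> 'cV[R]_n) (K : R) :
  (forall k, dotp (u k) (u k) <= K) ->
  exists U : set_system nat, exists l : 'cV[R]_n,
    [/\ ProperFilter U, \oo `<=` U & u @ U --> l].
Proof.
move=> uK; have [U [UU ooU]] := @ultraFilterLemma nat \oo _.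
have UP := @ultra_proper _ _ UU.
(* One ultrafilter serves all coordinates at once, without successive extractions. *)
have /choice[l ul] : forall i, exists l : R, u k i 0 @[k --> U] --> l.
  move=> i; apply: (@ultra_bounded_cvg _ _ _ _ (1 + K)) => // k.
  have K0 : 0 <= K := le_trans (dotp_ge0 _) (uK k).
  have := le_trans (sqr_coord_le_dotp (u k) i) (uK k).
  rewrite ler_norml; nra.
exists U, (\col_i l i); split=> //; apply/cvg_colP => i; rewrite mxE; exact: ul.
Qed.

(** * Subgradients of closed proper convex functions *)

Section Subdifferential.
Context {R : realType} {n : nat}.
Variable f : 'cV[R]_n -> \bar R.

(** If [f x] were [+oo], the subgradient inequality would make [f] equal to [+oo] everywhere. *)
Lemma subdifferential_fin_num x g :
  proper_fun f -> subdifferential f x g -> f x \is a fin_num.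
Proof.
move=> [fNy [y fy]] /(_ y); rewrite fin_numE fNy/=; apply: contraTneq => ->.
by rewrite addye// leye_eq.
Qed.

Lemma subdifferential_monotone x y g h :
  proper_fun f -> subdifferential f x g -> subdifferential f y h ->
  0 <= dotp (x - y) (g - h).
Proof.
move=> pf gx hy.
have := gx y; have := hy x.
rewrite -(fineK (subdifferential_fin_num pf gx)).
rewrite -(fineK (subdifferential_fin_num pf hy)).
rewrite -!EFinD !lee_fin -[y - x]opprB dotpNr.
by rewrite (dotpC (x - y)) dotpDl dotpNl; lra.
Qed.

(** For [f y = r] finite, the subgradient inequality says that [(x t, r - <g t, y - x t>)] lies in
    the epigraph, and this passes to the limit. *)
Lemma subdifferential_cvg (T : Type) (F : set_system T) (x g : T -> 'cV[R]_n)
    (x0 g0 : 'cV[R]_n) :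
  ProperFilter F -> closed_fun f -> proper_fun f ->
  (forall t, subdifferential f (x t) (g t)) ->
  x @ F --> x0 -> g @ F --> g0 -> subdifferential f x0 g0.
Proof.
move=> FF cf [fNy _] fg xx0 gg0 y.
case Ey : (f y) => [r| |]; last by have := fNy y; rewrite Ey.
  have d : r - dotp (g t) (y - x t) @[t --> F] --> r - dotp g0 (y - x0).
    apply: cvgB; first exact: cvg_cst.
    by apply: cvg_dotp => //; apply: cvgB => //; exact: cvg_cst.
  have : epigraph f (x0, r - dotp g0 (y - x0)).
    apply: (closed_cvg (F := F) (u_ := fun t => (x t, r - dotp (g t) (y - x t))) _ cf).
      apply: nearW => t; rewrite /epigraph/= EFinB leeBrDr//.
      by rewrite -Ey; exact: fg.
    exact: (cvg_pair xx0 d).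
  by rewrite /epigraph/= EFinB leeBrDr.
by rewrite leey.
Qed.

(** The subgradient is minus the gradient of the quadratic term. Instead of a sum rule, [z] is
    compared with [t y + (1 - t) z] for small [t]. *)
Lemma argmin_subdifferential (m : nat) (A : 'M[R]_(m, n)) (b : 'cV[R]_m) (rho : R) z :
  proper_fun f -> convex_fun f -> 0 <= rho ->
  argmin (fun z => (f z + (rho / 2 * l2norm (A *m z + b) ^+ 2)%R%:E)%E) z ->
  subdifferential f z (A^T *m (- rho *: (A *m z + b))).
Proof.
move=> [fNy [z0 fz0]] cf rho0 zmin y; have ffin : f z \is a fin_num.
  rewrite fin_numE fNy/=; have := zmin z0; apply: contraTneq => ->.
  have : f z0 \is a fin_num by rewrite fin_numE fNy.
  by move=> /fineK <-; rewrite addye// -EFinD leye_eq.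
case Ey : (f y) => [r| |]; [|by rewrite leey|by have := fNy y; rewrite Ey].
set w := A *m z + b; rewrite -(fineK ffin); set s := fine (f z).
rewrite -EFinD lee_fin dotpC -dotp_mull dotpZr.
set h := A *m (y - z); set C := rho / 2 * dotp h h.
have C0 : 0 <= C by rewrite mulr_ge0 ?divr_ge0// dotp_ge0.
(* Minimality at [t y + (1 - t) z] together with convexity of [f], divided by [t]. *)
have key (t : R) : 0 < t <= 1 -> 0 <= (r - s) + rho * dotp h w + t * C.
  move=> /andP[t0 t1]; have t01 : 0 <= t <= 1 by rewrite ltW.
  have := le_trans (zmin (t *: y + (1 - t) *: z)) (leeD2r _ (cf y z t t01)).
  have -> : A *m (t *: y + (1 - t) *: z) + b = w + t *: h.
    rewrite /w /h mulmxDr mulmxBr -!scalemxAr scalerBl scale1r scalerBr.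
    by apply/matrixP => i j; rewrite !mxE; ring.
  rewrite Ey -(fineK ffin) -/s -!EFinM -!EFinD lee_fin !sqr_l2norm -/w.
  clear C0; subst C; clearbody w h.
  rewrite dotpDr !dotpDl !(dotpZl, dotpZr) (dotpC w h) => le.
  rewrite -(pmulr_rge0 _ t0); move: le; lra.
rewrite mulNr lerBlDr -subr_ge0 leNgt; apply/negP => neg.
set a := (r - s) + rho * dotp h w in key.
have a0 : a < 0 by rewrite /a; lra.
have den : 0 < 2 * C - a by lra.
(* This [t] lies in []0, 1]] and makes [a + t C = a (C - a) / (2 C - a)] negative. *)
have := key (- a / (2 * C - a)).
rewrite divr_gt0 ?oppr_gt0// ler_pdivrMr// mul1r => /(_ ltac:(lra)).
apply/negP; rewrite -ltNge -(ltr_pM2r den) mul0r mulrDl.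
rewrite (_ : - a / _ * _ * _ = - a * C); last by field; rewrite gt_eqF.
nra.
Qed.

End Subdifferential.

(** Every index is paired with the [N - 1] others, once in each position; this is the source of the
    factor in [theta]. *)
Lemma sum_offdiag (R : comPzRingType) (N : nat) (a b : 'I_N -> R) :
  \sum_i \sum_(j | j != i) (a i + b j) =
  (N%:R - 1) * (\sum_i a i + \sum_i b i).
Proof.
have inner i : \sum_(j | j != i) (a i + b j) =
    (N%:R - 1) * a i + (\sum_j b j - b i).
  have := sumr_const 'I_N (a i); rewrite (bigD1 i)//= card_ord => aE.
  by rewrite big_split/= [\sum_j b j](bigD1 i)//= mulrBl mulr_natl -aE; ring.
rewrite (eq_bigr _ (fun i _ => inner i)) big_split/= -mulr_sumr sumrB.
by rewrite sumr_const card_ord -mulr_natl; ring.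
Qed.

(** * Optimality conditions of the iteration *)

Section JacobianADMM.
Context {R : realType} {N m : nat} {n : 'I_N -> nat}.
Variables (A : forall i, 'M[R]_(m, n i)) (c : 'cV[R]_m).
Variable f : forall i, 'cV[R]_(n i) -> \bar R.
Arguments f : clear implicits.
Hypothesis f_proper : forall i, proper_fun (f i).
Hypothesis f_convex : forall i, convex_fun (f i).
Hypothesis f_closed : forall i, closed_fun (f i).
Variables (rho : R) (x : nat -> forall i, 'cV[R]_(n i)) (lam : nat -> 'cV[R]_m).
Hypothesis rho_gt0 : 0 < rho.
Hypothesis admm : jacobian_admm A c f rho x lam.

(* The gap with lam k.+1 is due to the blocks being updated in parallel; the
   iterate is stationary for this multiplier, which depends on the block. *)
Definition admm_multiplier k i : 'cV[R]_m :=
  lam k.+1 + rho *: \sum_(j | j != i) A j *m (x k.+1 j - x k j).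

(** Optimality condition of the subproblem of block [i], with [lam k] eliminated by the dual
    update. *)
Lemma admm_subdifferential k i :
  subdifferential (f i) (x k.+1 i) ((A i)^T *m admm_multiplier k i).
Proof.
have [/(_ i) xmin lamk] := admm k.
pose b := \sum_(j < N | j != i) A j *m x k j - c - rho^-1 *: lam k.
have := @argmin_subdifferential _ _ (f i) _ (A i) b rho (x k.+1 i)
  (f_proper i) (f_convex (i:=i)) (ltW rho_gt0).
have -> : (fun z => (f i z + (rho / 2 * l2norm (A i *m z + b) ^+ 2)%:E)%E) =
  (fun z => (f i z + (rho / 2 * l2norm (A i *m z + \sum_(j < N | j != i) A j *m x k j
                    - c - rho^-1 *: lam k) ^+ 2)%:E)%E).
  by apply/funext => z; rewrite /b !addrA.
move=> /(_ xmin); congr (subdifferential _ _ (_ *m _)).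
rewrite /admm_multiplier lamk (bigD1 i)//= /b.
have -> : \sum_(j | j != i) A j *m (x k.+1 j - x k j) =
    \sum_(j | j != i) A j *m x k.+1 j - \sum_(j | j != i) A j *m x k j.
  by rewrite -sumrB; apply: eq_bigr => j _; rewrite mulmxBr.
apply/matrixP => p q; rewrite !mxE.
by field; rewrite gt_eqF.
Qed.

(** * The Lyapunov function of an arbitrary saddle point *)

Section Lyapunov.
Variables (xs : forall i, 'cV[R]_(n i)) (lams : 'cV[R]_m).
Hypothesis sad : saddle_point A c f xs lams.
Variable delta : R.
Hypothesis delta_ge0 : 0 <= delta.
Hypothesis near_orth : forall i j, i != j ->
  spectral_norm ((A i)^T *m A j) <= delta.

Let e k i := x k i - xs i.
Let mu k := lam k - lams.
Let theta := (N%:R - 1) * delta.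

Definition lyapunov k : R :=
  dotp (mu k) (mu k) / rho ^+ 2 + theta * \sum_i dotp (e k i) (e k i).

Let multiplier_step k : mu k.+1 = mu k - rho *: \sum_i A i *m e k.+1 i.
Proof.
have [_ Ax] := sad; have [_ lamk] := admm k.
rewrite /mu lamk; under [in RHS]eq_bigr do rewrite mulmxBr.
by rewrite sumrB Ax addrAC.
Qed.

Let monotone_step k : 0 <= \sum_i dotp (A i *m e k.+1 i)
  (mu k.+1 + rho *: \sum_(j | j != i) (A j *m e k.+1 j - A j *m e k j)).
Proof.
have [sub _] := sad; apply: sumr_ge0 => i _.
have := subdifferential_monotone (f_proper i) (@admm_subdifferential k i) (sub i).
rewrite -mulmxBr -dotp_mull; congr (0 <= dotp _ _).
rewrite /admm_multiplier /mu addrAC; congr (_ + _ *: _); apply: eq_bigr => j _.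
by rewrite -mulmxBr /e opprB addrA subrK.
Qed.

Lemma cross_term_le (u v : forall i, 'cV[R]_(n i)) i j : i != j ->
  2 * dotp (A i *m u i) (A j *m v j) <= delta * (dotp (u i) (u i) + dotp (v j) (v j)).
Proof.
move=> ij; rewrite dotp_mull mulmxA.
exact: dotp_mulmx_spectral_norm (near_orth ij) delta_ge0.
Qed.

Lemma lyapunov_descent k : lyapunov k.+1 +
  \sum_i (lambda_min ((A i)^T *m A i) - 3 * theta) * dotp (e k.+1 i) (e k.+1 i)
  <= lyapunov k.
Proof.
pose qq i j := dotp (A i *m e k.+1 i) (A j *m e k.+1 j).
pose qp i j := dotp (A i *m e k.+1 i) (A j *m e k j).
pose E1 i := dotp (e k.+1 i) (e k.+1 i); pose E0 i := dotp (e k i) (e k i).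
pose C1 := \sum_i \sum_(j | j != i) qq i j.
pose C2 := \sum_i \sum_(j | j != i) qp i j.
set S := \sum_i A i *m e k.+1 i.
(* Expansion of [|mu k|^2] with [mu k = mu k.+1 + rho S]. *)
have muS : 2 * dotp S (mu k.+1) =
    (dotp (mu k) (mu k) - dotp (mu k.+1) (mu k.+1)) / rho - rho * dotp S S.
  rewrite multiplier_step -/S; move: (mu k) S => a b.
  rewrite !(dotpDl, dotpDr, dotpNl, dotpNr, dotpZl, dotpZr) (dotpC a b).
  by field; rewrite gt_eqF.
have SS : dotp S S = \sum_i qq i i + C1.
  rewrite {1}/S dotp_suml -big_split/=; apply: eq_bigr => i _.
  by rewrite /S dotp_sumr (bigD1 i).
have mono : 0 <= dotp S (mu k.+1) + rho * (C1 - C2).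
  apply: le_trans (monotone_step k) _.
  rewrite -sumrB /S dotp_suml mulr_sumr -big_split/=; apply: ler_sum => i _.
  rewrite dotpDr dotpZr dotp_sumr -sumrB lerD2l ler_pM2l//.
  by apply: ler_sum => j _; rewrite dotpDr dotpNr.
(* The factor 3 of the rank condition is these [2 theta] plus the [theta] that [lyapunov k.+1]
   carries. *)
have cross : C1 - 2 * C2 <= theta * (2 * \sum_i E1 i + \sum_i E0 i).
  have le i j : j != i ->
      qq i j - 2 * qp i j <= 3 / 2 * delta * E1 i + delta * (E1 j / 2 + E0 j).
    rewrite eq_sym => ij.
    have := cross_term_le (e k.+1) (e k.+1) ij.
    (* The sign change turns the upper bound into one for [- 2 * qp i j]. *)
    have := cross_term_le (e k.+1) (fun j => - e k j) ij.
    rewrite mulmxN !dotpNr dotpNl opprK -/(E0 j) -/(E1 i) -/(E1 j).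
    by rewrite -/(qq i j) -/(qp i j); lra.
  rewrite mulr_sumr -sumrB.
  under eq_bigr do rewrite mulr_sumr -sumrB.
  apply: le_trans (ler_sum _ (fun i _ => ler_sum _ (fun j ji => le i j ji))) _.
  rewrite sum_offdiag -!mulr_sumr big_split/= -mulr_suml /theta le_eqVlt.
  by apply/orP; left; apply/eqP; field.
have coer : \sum_i lambda_min ((A i)^T *m A i) * E1 i <= \sum_i qq i i.
  apply: ler_sum => i _; rewrite /qq dotp_mull mulmxA lambda_min_le_rayleigh//.
  by rewrite trmx_mul trmxK.
rewrite /lyapunov -/E1 -/E0; under [X in _ + X <= _]eq_bigr do rewrite mulrBl.
rewrite sumrB -mulr_sumr.
have rho2 : 0 <= 2 / rho by rewrite divr_ge0// ltW.
have := mulr_ge0 rho2 mono.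
(* By [muS] and [SS], [- |S|^2] supplies the diagonal terms and cancels one of the two copies of
   [C1]. *)
have -> : 2 / rho * (dotp S (mu k.+1) + rho * (C1 - C2)) =
    dotp (mu k) (mu k) / rho ^+ 2 - dotp (mu k.+1) (mu k.+1) / rho ^+ 2
    - \sum_i qq i i + C1 - 2 * C2.
  rewrite (_ : _ * (_ + _) = rho^-1 * (2 * dotp S (mu k.+1)) + 2 * (C1 - C2)).
    by rewrite muS SS; field; rewrite gt_eqF.
  by field; rewrite gt_eqF.
by rewrite -/(E1 _); lra.
Qed.

Hypothesis N_gt0 : (0 < N)%N.
Hypothesis strong_rank : forall i, 3 * theta < lambda_min ((A i)^T *m A i).

Let theta_ge0 : 0 <= theta.
Proof. by rewrite mulr_ge0// subr_ge0 ler1n. Qed.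

Let lyapunov_ge_dual k : dotp (mu k) (mu k) / rho ^+ 2 <= lyapunov k.
Proof. by rewrite lerDl mulr_ge0// sumr_ge0// => i _; exact: dotp_ge0. Qed.

Let lyapunov_ge0 k : 0 <= lyapunov k.
Proof.
by rewrite (le_trans _ (lyapunov_ge_dual k))// divr_ge0 ?dotp_ge0 ?sqr_ge0.
Qed.

Let lyapunov_decrement k i :
  (lambda_min ((A i)^T *m A i) - 3 * theta) * dotp (e k.+1 i) (e k.+1 i)
  <= lyapunov k - lyapunov k.+1.
Proof.
rewrite lerBrDl; apply: le_trans (lyapunov_descent k); rewrite lerD2l (bigD1 i)//=.
by rewrite lerDl sumr_ge0// => j _; rewrite mulr_ge0 ?dotp_ge0// subr_ge0 ltW.
Qed.

Let lyapunov_le k : lyapunov k.+1 <= lyapunov k.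
Proof.
have i0 := Ordinal N_gt0; rewrite -subr_ge0; apply: le_trans (lyapunov_decrement k i0).
by rewrite mulr_ge0 ?dotp_ge0// subr_ge0 ltW.
Qed.

Lemma lyapunov_cvg : exists L : R, lyapunov @ \oo --> L.
Proof.
exists (inf (range lyapunov)); apply: nonincreasing_cvgn.
  exact/nonincreasing_seqP.
by exists 0 => _ [k _ <-].
Qed.

(** The squared error at step [k.+1] is at most the decrement of the Lyapunov function divided by
    [d], and the decrements of a convergent sequence tend to 0. *)
Lemma primal_cvg i : x k i @[k --> \oo] --> xs i.
Proof.
rewrite -(cvg_shiftS (fun k => x k i)); apply/cvg_dotp0P => /=.
have [L lL] := lyapunov_cvg.
set d := lambda_min ((A i)^T *m A i) - 3 * theta.
have d0 : 0 < d by rewrite subr_gt0.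
apply: (squeeze_cvgr (f := cst 0)
  (h := fun k => d^-1 * (lyapunov k - lyapunov k.+1))).
- apply: nearW => k /=; rewrite dotp_ge0/= ler_pdivlMl//.
  exact: lyapunov_decrement.
- exact: cvg_cst.
- rewrite -(mulr0 d^-1) -(subrr L); apply: cvgM; first exact: cvg_cst.
  by apply: cvgB => //; rewrite (cvg_shiftS lyapunov).
Qed.

Lemma dual_bounded k : dotp (mu k) (mu k) <= rho ^+ 2 * lyapunov 0.
Proof.
rewrite -ler_pdivrMl ?exprn_gt0// mulrC; apply: le_trans (lyapunov_ge_dual k) _.
by elim: k => // k; apply: le_trans; exact: lyapunov_le.
Qed.

(** The Lyapunov function has a limit along [\oo]; along [U] both its terms vanish, so this limit is
    0, and it dominates the dual error. *)
Lemma dual_cvg (U : set_system nat) : ProperFilter U -> \oo `<=` U ->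
  lam k.+1 @[k --> U] --> lams -> lam @ \oo --> lams.
Proof.
move=> UP ooU lamU.
have [L lL] := lyapunov_cvg.
have L0 : L = 0.
  apply: (cvg_unique _ (cvg_shiftS_sub ooU lL)); first exact: Rhausdorff.
  have mu0 : dotp (mu k.+1) (mu k.+1) @[k --> U] --> (0 : R).
    exact/(@cvg_dotp0P _ _ U UP).
  rewrite [0 in X in _ X](_ : 0 = 0 * (rho ^+ 2)^-1 + theta * 0); last first.
    by rewrite mul0r mulr0 addr0.
  apply: cvgD; first exact: cvgM mu0 (cvg_cst _).
  apply: cvgM; first exact: cvg_cst.
  apply: cvg_sum0 => i _; apply/(@cvg_dotp0P _ _ U UP _ (fun k => x k.+1 i)).
  exact: (cvg_shiftS_sub (u := x^~ i) ooU (@primal_cvg i)).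
apply/cvg_dotp0P; apply: (squeeze_cvgr (f := cst 0)
  (h := fun k => rho ^+ 2 * lyapunov k)).
- apply: nearW => k /=; rewrite dotp_ge0/= -ler_pdivrMl ?exprn_gt0// mulrC.
  exact: lyapunov_ge_dual.
- exact: cvg_cst.
- by rewrite -(mulr0 (rho ^+ 2)) -L0; apply: cvgM => //; exact: cvg_cst.
Qed.

(** Since [x k.+1 - x k] tends to 0, all the block multipliers share the limit [l] of [lam k.+1]
    along [U], and the subgradient relations pass to the limit. *)
Lemma dual_cluster : exists U : set_system nat, exists l : 'cV[R]_m,
  [/\ ProperFilter U, \oo `<=` U, lam k.+1 @[k --> U] --> l &
      saddle_point A c f xs l].
Proof.
have [U [l [UP ooU Ul]]] := bounded_cluster (fun k => dual_bounded k.+1).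
have lamU : lam k.+1 @[k --> U] --> l + lams.
  under eq_fun do rewrite -[lam _](subrK lams).
  by apply: cvgD => //; exact: cvg_cst.
exists U, (l + lams); split => //; split; last by have [] := sad.
have xU i : x k.+1 i @[k --> U] --> xs i.
  exact: (cvg_shiftS_sub (u := x^~ i) ooU (@primal_cvg i)).
have xU' i : x k i @[k --> U] --> xs i by move=> B /primal_cvg; exact: ooU.
move=> i; apply: (@subdifferential_cvg _ _ (f i) _ U (fun k => x k.+1 i)
  (fun k => (A i)^T *m admm_multiplier k i)) => //.
  by move=> k; exact: admm_subdifferential.
apply: cvg_mulmx; rewrite -[l + lams]addr0 -(scaler0 _ rho); apply: cvgD => //.
apply: cvgZl_tmp.
apply: cvg_sum0 => j _; rewrite -(mulmx0 _ (A j)); apply: cvg_mulmx.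
by rewrite -(subrr (xs j)); apply: (cvgB (xU j) (xU' j)).
Qed.

End Lyapunov.
End JacobianADMM.

Theorem theorem4p1 (R : realType) (N m : nat) (n : 'I_N -> nat)
    (A : forall i : 'I_N, 'M[R]_(m, n i)) (c : 'cV[R]_m)
    (f : forall i : 'I_N, 'cV[R]_(n i) -> \bar R)
    (hN : (2 <= N)%N)
    (f_proper : forall i, proper_fun (f i))
    (f_convex : forall i, convex_fun (f i))
    (f_closed : forall i, closed_fun (f i))
    (saddle_exists : exists (xs : forall i : 'I_N, 'cV[R]_(n i))
                            (lams : 'cV[R]_m), saddle_point A c f xs lams)
    (delta : R) (delta_gt0 : 0 < delta)
    (near_orth : forall i j : 'I_N, i != j ->
       spectral_norm ((A i)^T *m A j) <= delta)
    (strong_rank : forall i : 'I_N,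
       3 * (N%:R - 1) * delta < lambda_min ((A i)^T *m A i))
    (rho : R) (rho_gt0 : 0 < rho)
    (x : nat -> forall i : 'I_N, 'cV[R]_(n i)) (lam : nat -> 'cV[R]_m)
    (admm : jacobian_admm A c f rho x lam) :
  exists (xs : forall i : 'I_N, 'cV[R]_(n i)) (lams : 'cV[R]_m),
    [/\ saddle_point A c f xs lams,
        (forall i : 'I_N, (fun k : nat => x k i) @ \oo --> xs i) &
        lam @ \oo --> lams].
Proof.
have [xs [lams sad]] := saddle_exists.
have N0 : (0 < N)%N by exact: ltnW.
have rank i : 3 * ((N%:R - 1) * delta) < lambda_min ((A i)^T *m A i).
  by rewrite mulrA; exact: strong_rank.
have [U [l [UP ooU lamU sadl]]] := dual_cluster f_proper f_convex f_closed rho_gt0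
  admm sad (ltW delta_gt0) near_orth N0 rank.
exists xs, l; split=> // [i|].
  exact: (primal_cvg f_proper f_convex rho_gt0
    admm sadl (ltW delta_gt0) near_orth N0 rank).
(* Here the Lyapunov function is that of [(xs, l)]; the one of the initial [lams] need not tend to
   0. *)
exact: (dual_cvg f_proper f_convex rho_gt0
    admm sadl (ltW delta_gt0) near_orth N0 rank UP ooU lamU).
Qed.
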